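(* Let $B(t,x;321)=\sum_{n=0}^{\infty}\sum_{\pi\in\mathfrak{S}_n(321)}t^{\mathrm{bdes}(\pi)}x^n$. Then $$B(t,x;321)=\frac{2}{1-2(1-t)x^{2}+\sqrt{1-4x+4(1-t)x^{2}}}.$$
   Context: $\mathfrak{S}_n$ is the set of permutations $\pi=\pi_1\pi_2\cdots\pi_n$ of $[n]=\{1,\dots,n\}$ in one-line notation ($\mathfrak{S}_0$ consists of the empty permutation). $\mathfrak{S}_n(321)$ is the set of $\pi\in\mathfrak{S}_n$ having no length-three subsequence with the same relative order as $321$. An index $k\in[n-1]$ is a big descent of $\pi\in\mathfrak{S}_n$ if $\pi_k>\pi_{k+1}+1$; $\mathrm{bdes}(\pi)$ is the number of big descents of $\pi$. The identity is one of formal power series in $x$ with coefficients polynomials in $t$, the square root denoting the formal power series in $x$ with constant term $1$ whose square is the radicand. *)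

(* Defs.v *)
From HB Require Import structures.
From mathcomp Require Import all_boot all_order all_fingroup all_algebra.
From mathcomp Require Import boolp classical_sets.

Set Implicit Arguments.
Unset Strict Implicit.
Unset Printing Implicit Defensive.

Import GRing.Theory.
Local Open Scope ring_scope.

Record fps (R : Type) := Fps { fps_coef :> nat -> R }.

HB.instance Definition _ (R : Type) := gen_eqMixin (fps R).
HB.instance Definition _ (R : Type) := gen_choiceMixin (fps R).

Lemma fpsP (R : Type) (f g : fps R) : f =1 g <-> f = g.
Proof. by split=> [|->//]; case: f g => [f] [g] /= /funext ->. Qed.

Section FpsRing.
Variable R : comNzRingType.
Implicit Types f g h : fps R.

Definition fpsC (c : R) : fps R := Fps (fun n => if n is 0%N then c else 0).
Definition fpsX : fps R := Fps (fun n => (n == 1%N)%:R).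
Definition fps_add f g : fps R := Fps (fun n => f n + g n).
Definition fps_opp f : fps R := Fps (fun n => - f n).
Definition fps_mul f g : fps R :=
  Fps (fun n => \sum_(i < n.+1) f i * g (n - i)%N).

Fact fps_addA : associative fps_add.
Proof. by move=> f g h; apply/fpsP => n /=; rewrite addrA. Qed.
Fact fps_addC : commutative fps_add.
Proof. by move=> f g; apply/fpsP => n /=; rewrite addrC. Qed.
Fact fps_add0 : left_id (fpsC 0) fps_add.
Proof. by move=> f; apply/fpsP => -[|n] /=; rewrite add0r. Qed.
Fact fps_addN : left_inverse (fpsC 0) fps_opp fps_add.
Proof. by move=> f; apply/fpsP => -[|n] /=; rewrite addNr. Qed.

HB.instance Definition _ :=
  GRing.isZmodule.Build (fps R) fps_addA fps_addC fps_add0 fps_addN.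

Definition fps_trunc n f : {poly R} := \poly_(i < n) f i.

Lemma coef_fps_trunc n f i : (i < n)%N -> (fps_trunc n f)`_i = f i.
Proof. by move=> lt_in; rewrite coef_poly lt_in. Qed.

Lemma coef_fps_mul n f g i : (i < n)%N ->
  fps_mul f g i = (fps_trunc n f * fps_trunc n g)`_i.
Proof.
move=> lt_in; rewrite coefM; apply: eq_bigr => j _.
rewrite !coef_fps_trunc //; first exact: leq_ltn_trans (leq_subr _ _) lt_in.
exact: leq_ltn_trans (leq_ord j) lt_in.
Qed.

Fact fps_mulC : commutative fps_mul.
Proof.
by move=> f g; apply/fpsP => n; rewrite !(coef_fps_mul _ _ (ltnSn n)) mulrC.
Qed.

Fact fps_mulA : associative fps_mul.
Proof.
move=> f g h; apply/fpsP => n.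
transitivity ((fps_trunc n.+1 f * (fps_trunc n.+1 g * fps_trunc n.+1 h))`_n).
  rewrite coefM; apply: eq_bigr => j _; rewrite coef_fps_trunc //.
  by rewrite -coef_fps_mul // ltnS leq_subr.
rewrite mulrA coefM; apply: eq_bigr => j _.
by rewrite -coef_fps_mul // coef_fps_trunc // ltnS leq_subr.
Qed.

Fact fps_mul1 : left_id (fpsC 1) fps_mul.
Proof.
move=> f; apply/fpsP => n /=; rewrite big_ord_recl /= subn0 mul1r.
by rewrite big1 ?addr0 // => i _; rewrite mul0r.
Qed.

Fact fps_mulD : left_distributive fps_mul fps_add.
Proof.
move=> f g h; apply/fpsP => n /=; rewrite -big_split.
by apply: eq_bigr => i _; rewrite mulrDl.
Qed.

Fact fps_1neq0 : fpsC 1 != fpsC 0.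
Proof. by apply/eqP => /fpsP/(_ 0%N)/eqP; rewrite oner_eq0. Qed.

HB.instance Definition _ := GRing.Zmodule_isComNzRing.Build (fps R)
  fps_mulA fps_mulC fps_mul1 fps_mulD fps_1neq0.

Lemma fps_coef0 n : (0 : fps R) n = 0. Proof. by case: n. Qed.
Lemma fps_coef1 n : (1 : fps R) n = (n == 0%N)%:R. Proof. by case: n. Qed.
Lemma fps_coefC c n : fpsC c n = if n == 0%N then c else 0.
Proof. by case: n. Qed.
Lemma fps_coefX n : fpsX n = (n == 1%N)%:R. Proof. by []. Qed.
Lemma fps_coefD f g n : (f + g) n = f n + g n. Proof. by []. Qed.
Lemma fps_coefN f n : (- f) n = - f n. Proof. by []. Qed.
Lemma fps_coefB f g n : (f - g) n = f n - g n. Proof. by []. Qed.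
Lemma fps_coefM f g n : (f * g) n = \sum_(i < n.+1) f i * g (n - i)%N.
Proof. by []. Qed.

Lemma fps_coefM0 f g : (f * g) 0%N = f 0%N * g 0%N.
Proof. by rewrite fps_coefM big_ord1. Qed.

Lemma fps_coefCM c f n : (fpsC c * f) n = c * f n.
Proof.
rewrite fps_coefM big_ord_recl /= subn0 big1 ?addr0 // => i _.
by rewrite mul0r.
Qed.

Lemma fps_coefXM f n : (fpsX * f) n = if n is m.+1 then f m else 0.
Proof.
rewrite fps_coefM big_ord_recl /= mul0r add0r; case: n => [|n].
  by rewrite big_ord0.
rewrite big_ord_recl /= mul1r subSS subn0 big1 ?addr0 // => i _.
by rewrite mul0r.
Qed.

Fact fpsC_is_zmod_morphism : zmod_morphism fpsC.
Proof. by move=> a b; apply/fpsP => -[|n] //=; rewrite subr0. Qed.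
Fact fpsC_is_monoid_morphism : monoid_morphism fpsC.
Proof.
split=> // a b; apply/fpsP => -[|n]; rewrite fps_coefCM //=.
by rewrite mulr0.
Qed.
HB.instance Definition _ :=
  GRing.isZmodMorphism.Build R (fps R) fpsC fpsC_is_zmod_morphism.
HB.instance Definition _ :=
  GRing.isMonoidMorphism.Build R (fps R) fpsC fpsC_is_monoid_morphism.

(* The series whose n-th coefficient is F applied to its first n ones. *)
Section Recursion.
Variable F : seq R -> R.

Definition fps_rec_prefix n := iter n (fun s => rcons s (F s)) [::].
Definition fps_rec : fps R := Fps (fun n => F (fps_rec_prefix n)).

Lemma fps_recE n : fps_rec n = F (mkseq fps_rec n).
Proof.
congr F; elim: n => //= n IHn.
by rewrite {1}IHn -cats1 /mkseq -addn1 iotaD map_cat /= IHn.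
Qed.

End Recursion.

End FpsRing.

Arguments fpsX {R}.
Arguments fps_rec {R} F : simpl never.

Section FpsUnitRing.
Variable R : comUnitRingType.
Implicit Types f g : fps R.

Definition fps_unit : pred (fps R) := fun f => f 0%N \is a GRing.unit.

(* Outside the units the inverse is the identity, as in any unitRingType. *)
Definition fps_inv f : fps R :=
  if f 0%N \is a GRing.unit then
    fps_rec (fun s => (f 0%N)^-1 *
      ((size s == 0%N)%:R - \sum_(i < size s) s`_i * f (size s - i)%N))
  else f.

Fact fps_mulVf : {in fps_unit, left_inverse 1 fps_inv *%R}.
Proof.
move=> f; rewrite unfold_in /fps_unit => Uf; rewrite /fps_inv Uf.
set g := fps_rec _; apply/fpsP => n; rewrite fps_coefM big_ord_recr subnn.
rewrite [g (val _)]fps_recE size_mkseq -/g.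
under [X in _ - X]eq_bigr => i _ do rewrite nth_mkseq //.
rewrite mulrAC mulVr // mul1r addrC /=.
by rewrite addNKr; case: n.
Qed.

Fact fps_unitP f g : g * f = 1 -> fps_unit f.
Proof.
move/fpsP/(_ 0%N); rewrite fps_coefM0 mulrC => fg0.
by apply/unitrPr; exists (g 0%N).
Qed.

Fact fps_inv_out : {in [predC fps_unit], fps_inv =1 id}.
Proof. by move=> f; rewrite inE /= unfold_in /fps_inv => /negbTE->. Qed.

HB.instance Definition _ := GRing.ComNzRing_hasMulInverse.Build (fps R)
  fps_mulVf fps_unitP fps_inv_out.

Lemma fps_unitE f : (f \is a GRing.unit) = (f 0%N \is a GRing.unit).
Proof. by []. Qed.

(* Junk value 0 when there is no such square root; see fps_sqrtP. *)
Definition fps_sqrt f : fps R :=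
  xget 0 [set s : fps R | s 0%N = 1 /\ s ^+ 2 = f].

Lemma fps_sqrt_uniq (s r : fps R) : (2%:R : R) \is a GRing.unit ->
  s 0%N = 1 -> r 0%N = 1 -> s ^+ 2 = r ^+ 2 -> s = r.
Proof.
move=> U2 s0 r0 /eqP; rewrite -subr_eq0 subr_sqr => /eqP sr0.
have Usr : s + r \is a GRing.unit by rewrite fps_unitE fps_coefD s0 r0.
by apply/eqP; rewrite -subr_eq0 -(mulrK Usr (s - r)) sr0 mul0r.
Qed.

Lemma fps_sqrtP f : (2%:R : R) \is a GRing.unit -> f 0%N = 1 ->
  fps_sqrt f 0%N = 1 /\ fps_sqrt f ^+ 2 = f.
Proof.
move=> U2 f0; apply: (@xgetPex _ 0 [set s : fps R | s 0%N = 1 /\ s ^+ 2 = f]).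
pose F (s : seq R) := if size s is m.+1 then
  2%:R^-1 * (f (size s) - \sum_(i < m) s`_i.+1 * s`_(m - i)%N) else 1.
have [s sE] : exists s : fps R, forall n, s n = F (mkseq s n).
  by exists (fps_rec F) => n; apply: fps_recE.
have s0 : s 0%N = 1 by rewrite sE.
exists s; split=> //; apply/fpsP => -[|n]; rewrite expr2.
  by rewrite fps_coefM0 s0 mulr1.
rewrite fps_coefM big_ord_recl big_ord_recr /= subnn s0 mul1r mulr1.
under eq_bigr => i _ do rewrite /bump /= add1n subSS.
rewrite addrCA -mulr2n -mulr_natl [s _]sE /F size_mkseq mulVKr //.
under [X in _ - X]eq_bigr => i _.
  rewrite !nth_mkseq ?ltnS ?leq_subr ?(ltnW (ltn_ord i)) //.
  over.
by rewrite addrC subrK.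
Qed.

End FpsUnitRing.

(* Permutations of [n] are modelled as permutations of 'I_n, that is with
   positions and values both shifted down by one; this shift changes neither
   differences nor comparisons of values. *)
Section Permutations.
Variable n : nat.
Implicit Type p : 'S_n.

Definition avoids321 p : bool :=
  [forall i : 'I_n, forall j : 'I_n, forall k : 'I_n,
    ~~ [&& (i < j)%N, (j < k)%N, (p k < p j)%N & (p j < p i)%N]].

Definition big_descent p (k : 'I_n) : bool :=
  [exists l : 'I_n, (l == k.+1 :> nat) && ((p l).+1 < p k)%N].

Definition bdes p : nat := #|[set k : 'I_n | big_descent p k]|.

End Permutations.

(* Coefficients lie in Q[t], with t = 'X, rather than in Z[t]: this makes 2
   invertible, so that the quotient and the square root of the closed form
   are genuine ones (see fps_unitE and fps_sqrtP). *)
Definition B321 : fps {poly rat} :=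
  Fps (fun n => \sum_(p : 'S_n | avoids321 p) 'X ^+ bdes p).

(* Main.v *)
(* Build a 321-avoiding permutation from right to left, prefixing a letter i and
   shifting up the letters >= i.  Prefixing i > 0 keeps 321-avoidance exactly
   when the letters < i already occur in increasing order, and it creates a
   descent exactly when the permutation starts with its least letter; it also
   turns the small descent i, i - 1, if there is one, into a big descent.  To
   account for the latter, let F_h count the 321-avoiders whose letters < h
   increase, weighted by t to the number of descents that are big or have top h.
   With y := x - (1 - t) x^2, removing the first letter gives
     F_0 = 1 + F_1 + (1 - t) x^2 F_0   and   F_h = F_(h+1) + y F_(h-1)  (h > 0).
   As F_h is O(x^h), the linear recursion forces F_1 = z F_0 with z the small
   root of z (1 - z) = y, whence F_0, the series sought. *)

Require Import Defs.
From mathcomp Require Import all_boot all_order all_fingroup all_algebra.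
From mathcomp Require Import zify ring.

Import GRing.Theory.
Local Open Scope ring_scope.

Set Implicit Arguments.
Unset Strict Implicit.
Unset Printing Implicit Defensive.

(** * Permutations whose letters < h increase, and their marked descents *)

Definition incr_below h n (p : 'S_n) : bool :=
  [forall i : 'I_n, forall j : 'I_n,
    [&& (i < j)%N & (p j < p i)%N] ==> (h <= p i)%N].

Definition admissible h n (p : 'S_n) : bool := avoids321 p && incr_below h p.

(* Once h is prefixed, a descent h, h - 1 becomes h + 1, h - 1, hence is
   counted as big.  No descent has top 0, so h = 0 gives the usual big
   descents. *)
Definition mark h n (p : 'S_n) (k : 'I_n) : bool :=
  [exists l : 'I_n, [&& (l == k.+1 :> nat), (p l < p k)%N
                      & ((p l).+1 < p k)%N || (p k == h :> nat)]].

Definition nmarks h n (p : 'S_n) : nat := \sum_(k < n) mark h p k.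

Lemma incr_belowP h n (p : 'S_n) :
  reflect (forall i j : 'I_n, (i < j)%N -> (p j < p i)%N -> (h <= p i)%N)
          (incr_below h p).
Proof.
apply: (iffP forallP) => [H i j ij ji | H i].
  by move/forallP: (H i) => /(_ j)/implyP; apply; rewrite ij.
by apply/forallP => j; apply/implyP => /andP[]; apply: H.
Qed.

Lemma avoids321P n (p : 'S_n) :
  reflect (forall i j k : 'I_n, (i < j)%N -> (j < k)%N -> (p k < p j)%N ->
             ~ (p j < p i)%N)
          (avoids321 p).
Proof.
apply: (iffP forallP) => [H i j k ij jk kj ji | H i].
  move/forallP: (H i) => /(_ j)/forallP/(_ k).
  by rewrite ij jk kj ji.
apply/forallP => j; apply/forallP => k; apply/negP => /and4P[ij jk kj].
exact: H ij jk kj.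
Qed.

Lemma nmarks0 n (p : 'S_n) : nmarks 0 p = bdes p.
Proof.
rewrite /nmarks /bdes -sum1_card [RHS]big_mkcond; apply: eq_bigr => k _.
rewrite inE; suff -> : mark 0 p k = big_descent p k by case: big_descent.
by apply: eq_existsb => l; case: eqP => //= _; lia.
Qed.

(** * Prefixing a letter to a permutation *)

Section FirstLetter.
Variables (n : nat) (i : 'I_n.+1) (q : 'S_n).
Local Notation p := (lift_perm ord0 i q).

Lemma lift_perm_first : p ord0 = i. Proof. exact: lift_perm_id. Qed.

Lemma lift_perm_next (k : 'I_n) : p (lift ord0 k) = ((i <= q k) + q k)%N :> nat.
Proof. by rewrite lift_perm_lift. Qed.

Lemma avoids321_lift : avoids321 p = avoids321 q && incr_below i q.
Proof.
apply/avoids321P/andP => [H | [/avoids321P H /incr_belowP Hi] a b c].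
  split.
    apply/avoids321P => a b c ab bc cb ba.
    have := H (lift ord0 a) (lift ord0 b) (lift ord0 c).
    by rewrite !lift_perm_next !lift0; lia.
  apply/incr_belowP => a b ab ba.
  have := H ord0 (lift ord0 a) (lift ord0 b).
  by rewrite lift_perm_first !lift_perm_next !lift0 /=; lia.
case: (unliftP ord0 c) => [c' ->|-> //]; case: (unliftP ord0 b) => [b' ->|->//].
case: (unliftP ord0 a) => [a' ->|->];
  rewrite ?lift_perm_first !lift_perm_next !lift0.
  by have := H a' b' c'; lia.
by have := Hi b' c'; lia.
Qed.

Lemma incr_below_lift h : incr_below i q ->
  incr_below h p = if i == ord0 then incr_below h.-1 q else (h <= i)%N.
Proof.
move=> /incr_belowP Hi; case: (eqVneq i ord0) => [i0|i_neq0].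
  apply/incr_belowP/incr_belowP => H a b.
    have := H (lift ord0 a) (lift ord0 b).
    by rewrite !lift_perm_next !lift0 i0 /=; lia.
  case: (unliftP ord0 b) => [b' ->|-> //].
  case: (unliftP ord0 a) => [a' ->|->].
    by rewrite !lift_perm_next !lift0 i0 /=; have := H a' b'; lia.
  by rewrite lift_perm_first i0.
have i_gt0 : (0 < i)%N by rewrite lt0n.
have n_gt0 : (0 < n)%N by have := ltn_ord i; lia.
apply/incr_belowP/idP => [H|hi a b].
  (* The letter 0 comes after the first letter i > 0, so i is the top of an inversion. *)
  have /(_ isT) := H ord0 (lift ord0 ((q^-1)%g (Ordinal n_gt0))).
  by rewrite lift_perm_first !lift_perm_next permKV; apply => /=; lia.
case: (unliftP ord0 b) => [b' ->|-> //].
case: (unliftP ord0 a) => [a' ->|->]; rewrite ?lift_perm_first //.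
by rewrite !lift_perm_next !lift0; have := Hi a' b'; lia.
Qed.

Lemma admissible_lift h : admissible h p =
  if i == ord0 then admissible h.-1 q else (h <= i)%N && admissible i q.
Proof.
rewrite /admissible avoids321_lift.
have [Hi|/negP Hi] := boolP (incr_below i q).
  by rewrite incr_below_lift // !andbT; case: ifP => _ //; rewrite andbC.
rewrite !andbF /=; case: eqP => [i0|//].
by case: Hi; apply/incr_belowP => a b; rewrite i0.
Qed.

(** For i > 0 descents of [q] have top >= i, so their tops move up past h and only their sizes
    matter. A gap widens when the bottom is < i, which creates a big descent only if the top is
    i. *)
Lemma mark_lift h k : incr_below i q -> (i == ord0) || (h <= i)%N ->
  mark h p (lift ord0 k) = mark (if i == ord0 then h.-1 else i) q k.
Proof.
move=> /incr_belowP Hi hi; apply/existsP/existsP => [[l]|[l Hl]].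
  case: (unliftP ord0 l) => [l' ->|-> //] Hl; exists l'; move: Hl hi.
  have := Hi k l'; rewrite !lift_perm_next !lift0.
  by case: (eqVneq i ord0) => [->|_] /=; lia.
exists (lift ord0 l); move: Hl hi.
have := Hi k l; rewrite !lift_perm_next !lift0.
by case: (eqVneq i ord0) => [->|_] /=; lia.
Qed.

End FirstLetter.

(** As h <= i, the only descent i, 0 left unmarked is the small descent 1, 0 with h = 0. *)
Lemma mark_first h n (i : 'I_n.+2) (q : 'S_n.+1) :
  incr_below i q -> (h <= i)%N ->
  mark h (lift_perm ord0 i q) ord0
    = [&& i != ord0, q ord0 == ord0 & ~~ ((i == 1 :> nat) && (h == 0)%N)].
Proof.
move=> /incr_belowP Hi hi.
(* Such a letter would precede the 0, giving an inversion with top < i. *)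
have q0 : (0 < q ord0 < i)%N -> False.
  move=> q0i; have := Hi ord0 ((q^-1)%g ord0).
  rewrite permKV /=.
  have : (q^-1)%g ord0 != ord0.
    by apply: contraTneq q0i => /(congr1 q); rewrite permKV => <-.
  by rewrite -val_eqE /=; lia.
rewrite -2!val_eqE /=; apply/existsP/idP => [[l]|H].
  case: (unliftP ord0 l) => [l' ->|-> //].
  rewrite lift_perm_first lift_perm_next lift0 => /and3P[/eqP[l'0]].
  have -> : l' = ord0 by apply: val_inj.
  by lia.
exists (lift ord0 ord0).
rewrite lift_perm_first lift_perm_next lift0 /=; case/and3P: H => i_gt0 /eqP ->.
by lia.
Qed.

Lemma lift_perm_pair_bij n :
  bijective (fun iq : 'I_n.+1 * 'S_n => lift_perm ord0 iq.1 iq.2).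
Proof.
apply: inj_card_bij => [[i q] [j r] /= eq_ir|]; last first.
  by rewrite card_prod card_ord !card_Sn factS.
have eq_ij : i = j.
  by have /permP/(_ ord0) := eq_ir; rewrite !lift_perm_id.
rewrite -{}eq_ij in eq_ir *; congr (_, _); apply/permP => k.
have /permP/(_ (lift ord0 k)) := eq_ir; rewrite !lift_perm_lift.
exact: lift_inj.
Qed.

Lemma sum_first_letter (V : nmodType) n (G : 'S_n.+1 -> V) :
  \sum_p G p = \sum_(i < n.+1) \sum_(q : 'S_n) G (lift_perm ord0 i q).
Proof.
by rewrite pair_big (reindex _ (onW_bij _ (lift_perm_pair_bij n))).
Qed.

(** * Linear recursion for the weighted counts *)

Section Recursion.
Variables (R : comNzRingType) (t : R).

(* For h > n every permutation satisfies [incr_below h] vacuously; the guard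
   discards these. *)
Definition wsum n h : R :=
  if (h <= n)%N then \sum_(p : 'S_n | admissible h p) t ^+ nmarks h p else 0.

Lemma wsum_gt n h : (n < h)%N -> wsum n h = 0.
Proof. by rewrite /wsum ltnNge => /negbTE->. Qed.

Lemma wsum0 : wsum 0 0 = 1.
Proof.
rewrite /wsum /= (big_pred1 1%g) => [|p].
  by rewrite /nmarks big_ord0 expr0.
rewrite /= (_ : p = 1%g) ?eqxx; last by apply/permP => -[].
by apply/andP; split; [apply/avoids321P | apply/incr_belowP] => -[].
Qed.

Lemma weight_lift0 n h (q : 'S_n) :
  (if admissible h (lift_perm ord0 ord0 q)
   then t ^+ nmarks h (lift_perm ord0 ord0 q) else 0)
  = if admissible h.-1 q then t ^+ nmarks h.-1 q else 0.
Proof.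
rewrite admissible_lift eqxx; case: ifP => // _; congr (_ ^+ _).
have Hi : incr_below (@ord0 n) q by apply/incr_belowP.
rewrite /nmarks big_ord_recl.
under eq_bigr => k _ do rewrite mark_lift //.
rewrite (_ : mark _ _ _ = false) //; apply/existsP => -[l].
by rewrite lift_perm_first ltn0 andbF.
Qed.

(** Deleting the leading 0 lowers all letters and the threshold by one. These are the permutations
    before which a positive prefixed letter creates a descent. *)
Lemma sum_fixed_first n h :
  \sum_(q : 'S_n.+1 | admissible h.+1 q && (q ord0 == ord0)) t ^+ nmarks h.+1 q
  = \sum_(q : 'S_n | admissible h q) t ^+ nmarks h q.
Proof.
rewrite big_mkcondr big_mkcond sum_first_letter big_ord_recl /=.
rewrite [X in _ + X]big1 ?addr0 => [|i _]; last first.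
  by apply: big1 => q _; rewrite lift_perm_id; case: ifP.
rewrite [RHS]big_mkcond; apply: eq_bigr => q _.
by rewrite lift_perm_id eqxx weight_lift0.
Qed.

(** The first term is for first letter 0, the summand [i] for first letter i + 1. There a remainder
    starting with 0 gains a factor t, whence the correction by t - 1, except for the unmarked
    descent 1, 0. *)
Lemma wsumS n h : (h <= n.+1)%N ->
  wsum n.+1 h = wsum n h.-1
    + \sum_(i < n | (h <= i.+1)%N)
        (wsum n i.+1 + (if (i == 0 :> nat) && (h == 0)%N then 0
                        else (t - 1) * wsum n.-1 i)).
Proof.
move=> hn; rewrite {1}/wsum hn big_mkcond sum_first_letter big_ord_recl /=.
congr (_ + _).
  rewrite /wsum (_ : (h.-1 <= n)%N); last by lia.
  by rewrite [RHS]big_mkcond; apply: eq_bigr => q _; apply: weight_lift0.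
rewrite [RHS]big_mkcond; apply: eq_bigr => i _.
case: n i hn => [[]//|n] i hn.
case: ifP => hi; last first.
  by apply: big1 => q _; rewrite admissible_lift /= /bump add1n hi.
rewrite /wsum ltn_ord -ltnS ltn_ord.
transitivity (\sum_(q : 'S_n.+1 | admissible i.+1 q) t ^+ nmarks i.+1 q *
  t ^+ ((q ord0 == ord0) && ~~ ((i == 0 :> nat) && (h == 0)%N))).
  rewrite [RHS]big_mkcond; apply: eq_bigr => q _.
  rewrite admissible_lift /= /bump add1n hi /=; case: ifP => // /andP[_ Hi].
  rewrite -exprD addnC; congr (_ ^+ _); rewrite /nmarks big_ord_recl.
  rewrite mark_first //=; congr (_ + _)%N; apply: eq_bigr => k _.
  by rewrite mark_lift.
case: ifP => _.
  by rewrite addr0; apply: eq_bigr => q _; rewrite andbF expr0 mulr1.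
rewrite -[X in _ = _ + _ * X]sum_fixed_first [X in _ = _ + _ * X]big_mkcondr /=
   mulr_sumr -big_split /=.
apply: eq_bigr => q _; rewrite andbT; case: eqP => _ /=; ring.
Qed.

(** Subtract [wsumS] at h + 2 from [wsumS] at h + 1: the summand i = h remains, and its
    [wsum n h.+1] cancels the first term at h + 2. *)
Lemma wsumS_diff n h : wsum n.+1 h.+1 =
  wsum n.+1 h.+2 + wsum n h + (if n is m.+1 then (t - 1) * wsum m h else 0).
Proof.
have [hn|hn] := leqP h.+1 n.+1; last first.
  rewrite !wsum_gt ?addr0 ?add0r //; try lia.
  by case: n hn => // n hn; rewrite wsum_gt ?mulr0 //; lia.
rewrite wsumS //=; case: (ltngtP h n) => hn'; [|lia|]; last first.
  rewrite hn' big_pred0 => [|i]; last by have := ltn_ord i; lia.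
  rewrite [wsum n.+1 n.+2]wsum_gt // add0r.
  by case: n {hn hn'} => // n; rewrite [wsum n _]wsum_gt // mulr0.
rewrite wsumS //= (bigD1 (Ordinal hn')) //=.
under eq_bigr => i _ do rewrite andbF.
under [in RHS]eq_bigr => i _ do rewrite andbF.
rewrite (eq_bigl (fun i : 'I_n => (h.+2 <= i.+1)%N)) => [|i]; last first.
  by rewrite -val_eqE /=; lia.
case: n hn hn' => // n hn hn' /=; rewrite andbF; ring.
Qed.

(** Only the correction for the descent 1, 0 differs between [wsumS] at h = 0 and at h = 1. *)
Lemma wsumS_diff0 n : wsum n.+1 0 =
  wsum n.+1 1 - (if n is m.+1 then (t - 1) * wsum m 0 else 0).
Proof.
rewrite !wsumS //=; case: n => [|n] /=; first by rewrite !big_ord0 subr0.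
rewrite !big_ord_recl /=; ring.
Qed.

End Recursion.

(** * Generating functions and the closed form *)

Section GeneratingFunctions.
Variables (R : comUnitRingType) (t : R).
Local Notation T := (fpsC t : fps R).
Local Notation x := (fpsX : fps R).

Definition wgf h : fps R := Fps (fun n => wsum t n h).

Lemma wgf_rec h : wgf h.+1 = wgf h.+2 + (x - (1 - T) * x ^+ 2) * wgf h.
Proof.
have -> : (x - (1 - T) * x ^+ 2) * wgf h
    = x * (wgf h + x * (fpsC (t - 1) * wgf h)).
  by rewrite rmorphB rmorph1; ring.
apply/fpsP => -[|n]; rewrite fps_coefD fps_coefXM.
  by rewrite /= !wsum_gt // addr0.
rewrite fps_coefD fps_coefXM addrA.
by case: n => [|n]; rewrite ?fps_coefCM; apply: wsumS_diff.
Qed.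

Lemma wgf_rec0 : wgf 0 = 1 + wgf 1 + (1 - T) * x ^+ 2 * wgf 0.
Proof.
have -> : (1 - T) * x ^+ 2 * wgf 0 = - (x * (x * (fpsC (t - 1) * wgf 0))).
  by rewrite rmorphB rmorph1; ring.
apply/fpsP => -[|n]; rewrite fps_coefD fps_coefN fps_coefXM.
  by rewrite /= wsum0 wsum_gt // addr0 oppr0 addr0.
rewrite fps_coefD fps_coefXM fps_coef1 -[_%:R]/(0 : R) add0r.
by case: n => [|n]; rewrite ?fps_coefCM; apply: wsumS_diff0.
Qed.

(* [1 - v] is the root of [z * (1 - z) = y], y := x - (1 - T) x^2, that
   vanishes at x = 0.  The recursion multiplies the defect
   [wgf h.+1 - (1 - v) * wgf h] by [v] at each step, while its order in x is at
   least h; hence the defect is 0. *)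
Lemma wgf1 (v : fps R) : v \is a GRing.unit ->
  (1 - v) * v = x - (1 - T) * x ^+ 2 -> wgf 1 = (1 - v) * wgf 0.
Proof.
move=> Uv vE; pose D h := wgf h.+1 - (1 - v) * wgf h.
have DS h : D h.+1 = v * D h.
  have W2 : wgf h.+2 = wgf h.+1 - (1 - v) * v * wgf h.
    by rewrite [wgf h.+1]wgf_rec vE addrK.
  by rewrite /D W2; ring.
have DE h : D h = v ^+ h * D 0.
  by elim: h => [|h IHh]; rewrite ?expr0 ?mul1r // DS IHh exprS mulrA.
have D_small h n : (n < h)%N -> D h n = 0.
  have W_small k m : (m < k)%N -> wgf k m = 0 by apply: wsum_gt.
  move=> lt_nh; rewrite fps_coefB fps_coefM W_small ?ltnS 1?ltnW // sub0r.
  rewrite big1 ?oppr0 // => i _.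
  by rewrite W_small ?mulr0 // (leq_ltn_trans (leq_subr _ _)).
apply/eqP; rewrite -subr_eq0; apply/eqP/fpsP => n; rewrite fps_coef0.
rewrite -/(D 0) -(mulKr (unitrX n.+1 Uv) (D 0)) -DE fps_coefM.
by apply: big1 => i _; rewrite D_small ?mulr0 // ltnS leq_subr.
Qed.

Lemma wgf0E : (2%:R : R) \is a GRing.unit ->
  wgf 0 = 2%:R / (1 - 2%:R * (1 - T) * x ^+ 2
                  + fps_sqrt (1 - 4%:R * x + 4%:R * (1 - T) * x ^+ 2)).
Proof.
move=> U2; set f := 1 - 4%:R * x + _.
have f0 : f 0 = 1.
  by rewrite /f !(fps_coefD, fps_coefN, fps_coefM0, fps_coef1) /= !mulr0 oppr0
             !addr0.
have [] := fps_sqrtP U2 f0; set s := fps_sqrt f => s0 s2.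
have F2 : (2%:R : fps R) 0 = 2%:R by [].
have UF2 : (2%:R : fps R) \is a GRing.unit by rewrite fps_unitE F2.
(* The radicand is 1 - 4 y with y = x - (1 - T) x^2, so 1 - v = (1 - s) / 2 is the small root of z
   (1 - z) = y. *)
pose v := (1 + s) / 2%:R.
have v2 : 2%:R * v = 1 + s by rewrite mulrC divrK.
have sE : s = 2%:R * v - 1 by rewrite v2 addrC addKr.
have Uv : v \is a GRing.unit.
  by rewrite unitrM unitrV UF2 andbT fps_unitE fps_coefD s0.
have vE : (1 - v) * v = x - (1 - T) * x ^+ 2.
  apply: (mulrI UF2); apply: (mulrI UF2); move: s2.
  rewrite sE /f => s2; have -> : 2%:R * (2%:R * ((1 - v) * v))
    = 1 - (2%:R * v - 1) ^+ 2 by ring.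
  by rewrite s2; ring.
set d := _ + s; have Ud : d \is a GRing.unit.
  rewrite fps_unitE /d !(fps_coefD, fps_coefN, fps_coefM0, fps_coef1) /= s0.
  by rewrite !mulr0 subr0.
apply: (mulIr Ud); rewrite divrK // /d sE.
have W0 : wgf 0 = 1 + (1 - v) * wgf 0 + (1 - T) * x ^+ 2 * wgf 0.
  by rewrite -(wgf1 Uv vE) -wgf_rec0.
(* The denominator is 2 (v - (1 - T) x^2), and by [W0] the product of v - (1 - T) x^2 and [wgf 0] is
   1. *)
transitivity (2%:R * (wgf 0 - (1 - v) * wgf 0 - (1 - T) * x ^+ 2 * wgf 0)).
  by ring.
by rewrite [X in _ * (X - _ - _)]W0; ring.
Qed.

End GeneratingFunctions.

Theorem theorem2p8 :
  let t : fps {poly rat} := fpsC 'X in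
  let x : fps {poly rat} := fpsX in
  B321 = 2%:R / (1 - 2%:R * (1 - t) * x ^+ 2
                 + fps_sqrt (1 - 4%:R * x + 4%:R * (1 - t) * x ^+ 2)).
Proof.
move=> t x; rewrite -wgf0E; last first.
  by rewrite poly_unitE -polyC_natr size_polyC coefC unitfE.
apply/fpsP => n; rewrite /= /wsum /=; apply: eq_big => [p|p _].
  rewrite /admissible (_ : incr_below 0 p) ?andbT //.
  by apply/incr_belowP.
by rewrite nmarks0.
Qed.
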